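(* Let $X$ be a real normed space of dimension $n\ge1$. There is a least positive constant $C(X)$ such that $$\mathcal{H}(A,\operatorname{Co}(A))\le C(X)\,\sup_{t\in[0,1]}\mathcal{H}(tA+(1-t)A,A)$$ for every nonempty $A\subseteq X$, and this constant satisfies $$\log_2 n\le C(X)\le \kappa(n).$$ In particular $\log_2 n\le C(X)\le\lceil\log_2(n+1)\rceil\le \log_2 n+1$.
   Context: $d(x,A)=\inf\{\|x-a\|:a\in A\}$. The Hausdorff distance is $\mathcal{H}(A,B)=\sup\{d(x,B),d(y,A):x\in A,y\in B\}$; $\operatorname{Co}(A)$ is the convex hull. $\Delta_n=\{t\in\mathbb{R}^{n+1}: t_i\ge0,\sum t_i=1\}$ with vertices $e_1,\dots,e_{n+1}$. A function $f$ on a convex set $C$ is approximately convex if $f(tx+(1-t)y)\le tf(x)+(1-t)f(y)+1$ for all $x,y\in C$, $t\in[0,1]$. $\kappa(n)=\sup\{f(x): x\in\Delta_n,\ f:\Delta_n\to\mathbb{R}\text{ approximately convex with } f(e_i)\le0\ \forall i\}$. *)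

(* Defs.v *)
From HB Require Import structures.
From mathcomp Require Import all_boot all_order all_algebra.
From mathcomp Require Import all_classical all_reals all_analysis.
Set Implicit Arguments. Unset Strict Implicit. Unset Printing Implicit Defensive.
Import Order.TTheory GRing.Theory Num.Theory.
Import numFieldNormedType.Exports.
Local Open Scope classical_set_scope.
Local Open Scope ring_scope.

Definition pdist {R : realType} {X : normedModType R} (x : X) (A : set X) : \bar R :=
  ereal_inf [set (`|x - a|)%:E | a in A].

Definition hausdorff {R : realType} {X : normedModType R} (A B : set X) : \bar R :=
  ereal_sup ([set pdist x B | x in A] `|` [set pdist y A | y in B]).

Definition convex_hull {R : realType} {X : normedModType R} (A : set X) : set X :=
  [set x | exists (k : nat) (a : 'I_k -> X) (w : 'I_k -> R),
     [/\ forall i, A (a i), forall i, 0 <= w i, \sum_(i < k) w i = 1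
       & x = \sum_(i < k) w i *: a i]].

Definition mink_comb {R : realType} {X : normedModType R} (t : R) (A : set X) : set X :=
  [set t *: a + (1 - t) *: b | a in A & b in A].

Definition nonconvexity {R : realType} {X : normedModType R} (A : set X) : \bar R :=
  ereal_sup [set hausdorff (mink_comb t A) A | t in `[0, 1]%classic].

Definition admissible_const {R : realType} (X : normedModType R) (C : R) : Prop :=
  0 < C /\ forall A : set X, A !=set0 ->
    (hausdorff A (convex_hull A) <= C%:E * nonconvexity A)%E.

Definition std_simplex {R : realType} (n : nat) : set 'rV[R]_n.+1 :=
  [set t | (forall i, 0 <= t ord0 i) /\ \sum_(i < n.+1) t ord0 i = 1].

Arguments std_simplex {R} n.

Definition simplex_vertex {R : realType} (n : nat) (i : 'I_n.+1) : 'rV[R]_n.+1 :=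
  \row_(j < n.+1) (if j == i then 1 else 0).

Arguments simplex_vertex {R} n i.

Definition approx_convex {R : realType} {V : lmodType R} (C : set V) (f : V -> R) : Prop :=
  forall x y (t : R), C x -> C y -> 0 <= t <= 1 ->
    f (t *: x + (1 - t) *: y) <= t * f x + (1 - t) * f y + 1.

Definition kappa {R : realType} (n : nat) : \bar R :=
  ereal_sup [set z : \bar R | exists (f : 'rV[R]_n.+1 -> R) (x : 'rV[R]_n.+1),
    [/\ approx_convex (std_simplex n) f,
       (forall i, f (simplex_vertex n i) <= 0),
       std_simplex n x & z = (f x)%:E]].

Definition log2 {R : realType} (x : R) : R := ln x / ln 2.

(* Main.v *)
Require Import Defs.
From HB Require Import structures.
From mathcomp Require Import all_boot all_order all_algebra.
From mathcomp Require Import all_classical all_reals all_analysis.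
From mathcomp Require Import ring lra.
Set Implicit Arguments. Unset Strict Implicit. Unset Printing Implicit Defensive.
Import Order.TTheory GRing.Theory Num.Theory.
Import numFieldNormedType.Exports.
Local Open Scope classical_set_scope.
Local Open Scope ring_scope.

(** Upper bound: if [nonconvexity A < r], then [d(., A) / r] is approximately
    convex on [X] and vanishes on [A]. By Caratheodory a point of the hull of
    [A] is the image of a point of [std_simplex n] under an affine map sending
    the vertices into [A], so its distance to [A] is at most [kappa n * r].
    Halving supports shows that an approximately convex function which is
    nonpositive at the vertices is at most [k] where the support has at most
    [2 ^ k] points, whence [kappa n <= up_log 2 n.+1].

    Lower bound: Shannon entropy in base 2 is approximately convex on the
    simplex with [n] vertices, vanishes at the vertices, and equals [log2 n] at
    the centre. Blow that simplex up by a factor [M] in an affine hyperplane of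
    [X], and let [A] be the epigraph of the entropy over it in a unit direction
    [v] almost orthogonal to the hyperplane. Then [nonconvexity A <= 1], the
    centre lies in the hull of [A], and as [M] grows its distance to [A] tends
    to almost [log2 n], since the entropy becomes flat near the centre. *)

(** * Distances and nonconvexity *)

Section Distance.
Context {R : realType} {X : normedModType R}.
Implicit Types (A B : set X) (x y : X) (r s t : R).

Lemma pdist_ge0 x A : (0 <= pdist x A)%E.
Proof. by apply: le_ereal_inf_tmp => _ [a Aa <-]; rewrite lee_fin. Qed.

Lemma pdist_le x A a : A a -> (pdist x A <= `|x - a|%:E)%E.
Proof. by move=> Aa; apply: ge_ereal_inf; exists `|x - a|%:E => //; exists a. Qed.

Lemma pdist_lt x A r : (pdist x A < r%:E)%E -> exists2 a, A a & `|x - a| < r.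
Proof.
by move=> /ereal_inf_lt[_ [a Aa <-]]; rewrite lte_fin => xar; exists a.
Qed.

Lemma pdist_fin_num x A : A !=set0 -> pdist x A \is a fin_num.
Proof.
move=> [a Aa]; rewrite ge0_fin_numE ?pdist_ge0//.
exact: le_lt_trans (pdist_le x Aa) (ltry _).
Qed.

Lemma pdist_mem x A : A x -> pdist x A = 0%E.
Proof.
move=> Ax; apply/eqP; rewrite eq_le pdist_ge0 andbT.
by have := pdist_le x Ax; rewrite subrr normr0.
Qed.

Lemma sub_convex_hull A : A `<=` convex_hull A.
Proof.
move=> x Ax; exists 1%N, (fun=> x), (fun=> 1); split=> //.
- by rewrite big_ord1.
- by rewrite big_ord1 scale1r.
Qed.

Lemma hausdorff_le A B r : 0 <= r -> A `<=` B ->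
  (forall y, B y -> (pdist y A <= r%:E)%E) -> (hausdorff A B <= r%:E)%E.
Proof.
move=> r0 AB BA; apply: ge_ereal_sup => _ [[x Ax <-]|[y By <-]].
- by rewrite (pdist_mem (AB _ Ax)) lee_fin.
- exact: BA.
Qed.

Lemma pdist_le_hausdorff A B y : B y -> (pdist y A <= hausdorff A B)%E.
Proof. by move=> By; apply: ereal_sup_ubound; right; exists y. Qed.

Lemma sub_mink_comb A t : A `<=` mink_comb t A.
Proof.
by move=> a Aa; exists a => //; exists a => //; rewrite -scalerDl subrKC scale1r.
Qed.

Lemma pdist_mink_le A t a b : 0 <= t <= 1 -> A a -> A b ->
  (pdist (t *: a + (1 - t) *: b)%R A <= nonconvexity A)%E.
Proof.
move=> t01 Aa Ab; apply: le_ereal_sup_tmp; exists (hausdorff (mink_comb t A) A).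
  by exists t => //=; rewrite in_itv.
by apply: ereal_sup_ubound; left; exists (t *: a + (1 - t) *: b) => //;
  exists a => //; exists b.
Qed.

Lemma nonconvexity_le A r : 0 <= r ->
  (forall t a b, 0 <= t <= 1 -> A a -> A b ->
    (pdist (t *: a + (1 - t) *: b)%R A <= r%:E)%E) ->
  (nonconvexity A <= r%:E)%E.
Proof.
move=> r0 Ar; apply: ge_ereal_sup => _ [t /= + <-]; rewrite in_itv/= => t01.
apply: ge_ereal_sup => _ [[_ [a Aa [b Ab <-]] <-]|[y Ay <-]]; first exact: Ar.
by rewrite (pdist_mem (@sub_mink_comb A t _ Ay)) lee_fin.
Qed.

Lemma nonconvexity_ge0 A : A !=set0 -> (0 <= nonconvexity A)%E.
Proof.
move=> [a Aa]; apply: (le_trans (pdist_ge0 (1 *: a + (1 - 1) *: a) A)).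
by apply: pdist_mink_le => //; rewrite ler01 lexx.
Qed.

(** Take [a], [b], [c] in [A] nearly nearest to [x], [y] and [t *: a + (1 - t) *: b], and apply the
    triangle inequality. Infima need not be attained: the gap [r - s] pays half for [a] and [b],
    half for [c]. *)
Lemma approx_convex_pdist A r : A !=set0 -> (nonconvexity A < r%:E)%E ->
  approx_convex setT (fun x => fine (pdist x A) / r).
Proof.
move=> A0 Ar x y t _ _ /andP[t0 t1].
have N0 := nonconvexity_ge0 A0.
have Nfin : nonconvexity A \is a fin_num.
  by rewrite ge0_fin_numE// (lt_trans Ar) ?ltry.
move: N0 Ar; rewrite -(fineK Nfin) lee_fin lte_fin; set s := fine _ => s0 sr.
have r0 : 0 < r by exact: le_lt_trans sr.
have e0 : 0 < (r - s) / 2 by lra.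
have near z : exists2 a, A a & `|z - a| < fine (pdist z A) + (r - s) / 2.
  apply: pdist_lt; rewrite EFinD fineK ?pdist_fin_num//.
  by rewrite lteDl ?pdist_fin_num// lte_fin.
have [a Aa xa] := near x; have [b Ab yb] := near y.
have [c Ac zc] : exists2 c, A c & `|t *: a + (1 - t) *: b - c| < s + (r - s) / 2.
  apply: pdist_lt; apply: (@le_lt_trans _ _ s%:E); last by rewrite lte_fin; lra.
  by rewrite /s (fineK Nfin); apply: pdist_mink_le => //; rewrite t0.
rewrite -(ler_pM2r r0) mulfVK ?gt_eqF// -lee_fin fineK ?pdist_fin_num//.
apply: le_trans (pdist_le _ Ac) _; rewrite lee_fin.
have -> : t *: x + (1 - t) *: y - c =
    t *: (x - a) + (1 - t) *: (y - b) + (t *: a + (1 - t) *: b - c).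
  by rewrite !scalerBr [X in _ = X + _]addrACA -opprD addrA subrK.
have t1' : 0 <= 1 - t by rewrite subr_ge0.
apply: le_trans (ler_normD _ _) _.
apply: le_trans (lerD (ler_normD _ _) (ltW zc)) _.
rewrite !normrZ (ger0_norm t0) (ger0_norm t1').
have tx := ler_wpM2l t0 (ltW xa); have ty := ler_wpM2l t1' (ltW yb).
apply: le_trans (lerD (lerD tx ty) (lexx _)) _.
set p := fine _; set q := fine _.
have -> : (t * (p / r) + (1 - t) * (q / r) + 1) * r = t * p + (1 - t) * q + r.
  by field; rewrite gt_eqF.
by lra.
Qed.

End Distance.

Lemma approx_convex_comp {R : realType} {U V : lmodType R} (C : set U)
    (D : set V) (f : V -> R) (g : U -> V) :
  (forall x, C x -> D (g x)) ->
  (forall t x y, g (t *: x + (1 - t) *: y) = t *: g x + (1 - t) *: g y) ->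
  approx_convex D f -> approx_convex C (f \o g).
Proof.
move=> CD g_affine fD x y t Cx Cy t01 /=.
by rewrite g_affine; apply: fD => //; exact: CD.
Qed.

(** * Caratheodory's theorem *)

Section Caratheodory.
Context {R : realType} {X : lmodType R} {n : nat}.
Variables (e : {linear 'rV[R]_n -> X}) (e_bij : bijective e).

(** The rows formed by the coordinates of [a i] followed by a 1 are [k] vectors in dimension
    [n + 1 < k]. A nonzero left kernel vector gives the coefficients. *)
Lemma affine_dependence k (a : 'I_k -> X) : (n.+1 < k)%N ->
  exists l : 'I_k -> R, [/\ \sum_i l i = 0, \sum_i l i *: a i = 0
    & exists i, 0 < l i].
Proof.
move=> nk; have [g gK eK] := e_bij.
pose M : 'M[R]_(k, n + 1) := row_mx (\matrix_i g (a i)) (const_mx 1).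
have : kermx M != 0.
  rewrite kermx_eq0 /row_free neq_ltn (leq_ltn_trans (rank_leq_col M))//.
  by rewrite addn1.
move=> /rowV0Pn[v /sub_kermxP vM v0].
move: vM; rewrite mul_mx_row -[RHS]row_mx0 => /eq_row_mx[vM1 vM2].
have vs : \sum_i v 0 i = 0.
  move/matrixP/(_ 0 0): vM2; rewrite !mxE => vM2; rewrite -[RHS]vM2.
  by apply: eq_bigr => i _; rewrite mxE mulr1.
exists (v 0); split => //.
- have := congr1 e vM1; rewrite linear0 mulmx_sum_row linear_sum => ve0.
  rewrite -[RHS]ve0; apply: eq_bigr => i _; by rewrite linearZ/= rowK eK.
(* A vector with zero sum and no positive entry would vanish. *)
- apply/not_existsP => vle0; case/negP: v0; apply/eqP/rowP => j; rewrite mxE.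
  have {}vle0 i : v 0 i <= 0 by rewrite leNgt; apply/negP/vle0.
  apply/eqP; rewrite eq_le vle0/= -oppr_le0.
  move: vs => /eqP; rewrite (bigD1 j)//= addrC addr_eq0 => /eqP <-.
  by apply: sumr_le0.
Qed.

(** Subtract from [w] the multiple of the dependence [l] at which a coefficient first reaches 0.
    This happens at the index [j] minimising [w i / l i] over [0 < l i], and the other coefficients
    stay nonnegative. *)
Lemma caratheodory_step k (a : 'I_k.+1 -> X) (w : 'I_k.+1 -> R) :
  (n < k)%N -> (forall i, 0 <= w i) ->
  exists (j : 'I_k.+1) (w' : 'I_k -> R), [/\ forall i, 0 <= w' i,
    \sum_i w' i = \sum_i w i
    & \sum_i w' i *: a (lift j i) = \sum_i w i *: a i].
Proof.
move=> nk w0.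
have [l [ls la [i0 li0]]] : exists l : 'I_k.+1 -> R, [/\ \sum_i l i = 0,
  \sum_i l i *: a i = 0 & exists i, 0 < l i] by exact: affine_dependence.
pose j := [arg min_(i < i0 | 0 < l i) (w i / l i)]%O.
have [lj jmin] : 0 < l j /\ forall i, 0 < l i -> w j / l j <= w i / l i.
  by rewrite /j; case: arg_minP.
pose u i := w i - w j / l j * l i.
have uj : u j = 0 by rewrite /u divfK ?subrr// gt_eqF.
have us : \sum_i u i = \sum_i w i.
  by rewrite sumrB -mulr_sumr ls mulr0 subr0.
have ua : \sum_i u i *: a i = \sum_i w i *: a i.
  under eq_bigr do rewrite scalerBl -scalerA.
  by rewrite sumrB -scaler_sumr la scaler0 subr0.
exists j, (u \o lift j); split.
- move=> i; rewrite /= /u subr_ge0; set h := lift j i.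
  have [lh|lh] := leP (l h) 0.
    apply: le_trans (w0 h); rewrite mulr_ge0_le0// divr_ge0//; exact: ltW.
  by rewrite -ler_pdivlMr// jmin.
- by rewrite -us [RHS](bigD1_ord j)//= uj add0r.
- by rewrite -ua [RHS](bigD1_ord j)//= uj scale0r add0r.
Qed.

End Caratheodory.

(** Induction on the excess [m] of the number of points over [n.+1]. A combination of fewer points
    is padded with zero weights to exactly [n.+1]. *)
Lemma caratheodory {R : realType} {X : normedModType R} {n : nat}
    (e : {linear 'rV[R]_n -> X}) (A : set X) x :
  bijective e -> convex_hull A x ->
  exists (a : 'I_n.+1 -> X) (w : 'rV[R]_n.+1),
    [/\ forall i, A (a i), std_simplex n w & x = \sum_i w 0 i *: a i].
Proof.
move=> e_bij [k [a [w [Aa w0 ws ->]]]].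
have [m km] : exists m, (k <= m + n.+1)%N by exists k; rewrite leq_addr.
elim: m k km a w Aa w0 ws => [|m IH] k km a w Aa w0 ws; last first.
  have [|mk] := leqP k (m + n.+1); first by move=> /IH; exact.
  case: k => // k in km mk a w Aa w0 ws *.
  have nk : (n < k)%N by exact: leq_trans (leq_addl m _) mk.
  have [j [w' [w'0 w's <-]]] := caratheodory_step e_bij a nk w0.
  by apply: IH => //; rewrite w's.
have k0 : (0 < k)%N.
  case: k {km a w0 Aa} w ws => // w; rewrite big_ord0 => /esym/eqP.
  by rewrite oner_eq0.
rewrite add0n in km.
(* Padding indices, those with [k <= i], repeat the point of index 0; [k0] guarantees that it
   exists. *)
pose h (i : 'I_n.+1) := odflt (Ordinal k0) (insub (nat_of_ord i) : option 'I_k).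
have hw (i : 'I_k) : h (widen_ord km i) = i by rewrite /h/= valK.
pose v := \row_(i < n.+1) if (i < k)%N then w (h i) else 0.
have sumv (V : zmodType) (F : 'I_n.+1 -> V) (G : 'I_k -> V) :
    (forall i, F (widen_ord km i) = G i) ->
    (forall i : 'I_n.+1, ~~ (i < k)%N -> F i = 0) -> \sum_i F i = \sum_i G i.
  move=> FG F0; rewrite (bigID (fun i : 'I_n.+1 => (i < k)%N))/=.
  have -> : \sum_(i < n.+1 | ~~ (i < k)%N) F i = 0 by apply: big1 => i /F0.
  rewrite addr0.
  by rewrite (big_ord_narrow km)/=; apply: eq_bigr => i _; exact: FG.
exists (a \o h), v; split.
- by move=> i; exact: Aa.
- split; first by move=> i; rewrite mxE; case: ifP.
  rewrite -ws; apply: sumv => i; rewrite mxE /=; first by rewrite ltn_ord hw.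
  by move=> /negbTE ->.
- apply/esym/sumv => i; rewrite mxE /=; first by rewrite ltn_ord hw.
  by move=> /negbTE ->; rewrite scale0r.
Qed.

(** * Bounds on [kappa] *)

Section Kappa.
Context {R : realType}.

Definition simplex_support n (x : 'rV[R]_n.+1) : {set 'I_n.+1} :=
  [set i | x ord0 i != 0]%SET.

Lemma in_simplex_support n (x : 'rV[R]_n.+1) i :
  (i \in simplex_support x) = (x ord0 i != 0).
Proof. by rewrite inE. Qed.

Lemma std_simplex_support1 n (x : 'rV[R]_n.+1) : std_simplex n x ->
  (#|simplex_support x| <= 1)%N -> exists i, x = simplex_vertex n i.
Proof.
move=> [x0 xs] /card_le1_eqP S1.
have [i xi] : exists i, x ord0 i != 0.
  apply/not_existsP => xall; move: xs; rewrite big1 => [/esym/eqP|i _].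
    by rewrite oner_eq0.
  by apply/eqP/negPn/negP/xall.
have xj j : j != i -> x ord0 j = 0.
  move=> ji; apply: contraNeq ji => xj; apply/eqP.
  by apply: S1; rewrite in_simplex_support.
exists i; apply/rowP => j; rewrite mxE; have [->|/xj//] := eqVneq j i.
by rewrite -xs (bigD1 i)//= big1 ?addr0.
Qed.

(* The normalised restrictions of [x] to the two halves of its support. *)
Lemma std_simplex_split n (x : 'rV[R]_n.+1) (T : {set 'I_n.+1}) :
  std_simplex n x -> (exists2 i, i \in T & x ord0 i != 0) ->
  (exists2 i, i \notin T & x ord0 i != 0) ->
  exists (t : R) (y z : 'rV[R]_n.+1), [/\ 0 <= t <= 1,
    std_simplex n y /\ std_simplex n z,
    forall i, (y ord0 i != 0) = (i \in T) && (x ord0 i != 0),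
    forall i, (z ord0 i != 0) = (i \notin T) && (x ord0 i != 0)
    & x = t *: y + (1 - t) *: z].
Proof.
move=> [x0 xs] [i iT xi] [j jT xj].
pose t := \sum_(k in T) x ord0 k; pose u := \sum_(k | k \notin T) x ord0 k.
have tu : t + u = 1 by rewrite -xs [RHS](bigID (mem T)).
have t0 : 0 < t.
  rewrite /t (bigD1 i)//= ltr_pwDl ?lt_def ?xi ?x0//.
  by apply: sumr_ge0.
have u0 : 0 < u.
  rewrite /u (bigD1 j)//= ltr_pwDl ?lt_def ?xj ?x0//.
  by apply: sumr_ge0.
have uE : 1 - t = u by rewrite -tu addrAC subrr add0r.
pose y := \row_k (if k \in T then x ord0 k / t else 0).
pose z := \row_k (if k \notin T then x ord0 k / u else 0).
exists t, y, z; split.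
- by rewrite (ltW t0)/= -subr_ge0 uE ltW.
- split; split=> [k|].
  + by rewrite mxE; case: ifP => // _; rewrite divr_ge0// ltW.
  + under eq_bigr do rewrite mxE.
    by rewrite -big_mkcond/= -mulr_suml divff// gt_eqF.
  + by rewrite mxE; case: ifP => // _; rewrite divr_ge0// ltW.
  + under eq_bigr do rewrite mxE.
    by rewrite -big_mkcond/= -mulr_suml divff// gt_eqF.
- move=> k; rewrite mxE; case: ifP => _; last by rewrite eqxx.
  by rewrite mulf_eq0 invr_eq0 (gt_eqF t0) orbF.
- move=> k; rewrite mxE; case: ifP => _; last by rewrite eqxx.
  by rewrite mulf_eq0 invr_eq0 (gt_eqF u0) orbF.
- apply/rowP => k; rewrite !mxE uE; case: ifP => _ /=.
    by rewrite mulr0 addr0 mulrC divfK// gt_eqF.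
  by rewrite mulr0 add0r mulrC divfK// gt_eqF.
Qed.

(** Each halving of the support costs the 1 allowed by approximate convexity, and [k] halvings lead
    down to a vertex. *)
Lemma approx_convex_support_le n (f : 'rV[R]_n.+1 -> R) k :
  approx_convex (std_simplex n) f -> (forall i, f (simplex_vertex n i) <= 0) ->
  forall x, std_simplex n x -> (#|simplex_support x| <= 2 ^ k)%N ->
  f x <= k%:R.
Proof.
move=> fc fv; elim: k => [|k IH] x Sx cx.
  by have [i ->] := std_simplex_support1 Sx cx; exact: fv.
have [small|big] := leqP #|simplex_support x| (2 ^ k).
  by apply: le_trans (IH _ Sx small) _; rewrite ler_nat.
set S := simplex_support x in cx big *.
(* [T] takes exactly [2 ^ k] points of the support, leaving at least one and at most [2 ^ k], so
   both pieces carry mass. *)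
have [T /setIdP[]] : exists T, T \in
    [set T : {set 'I_n.+1} | T \subset S & #|T| == (2 ^ k)%N]%SET.
  by apply/set0Pn; rewrite -card_gt0 cards_draws bin_gt0 ltnW.
move=> TS /eqP cT.
have cD : (#|S :\: T| <= 2 ^ k)%N.
  by rewrite cardsD (finset.setIidPr TS) cT leq_subLR addnn -mul2n -expnS.
have [i iT] : exists i, i \in T.
  by apply/set0Pn; rewrite -card_gt0 cT expn_gt0.
have [j] : exists j, j \in S :\: T.
  by apply/set0Pn; rewrite -card_gt0 cardsD (finset.setIidPr TS) cT subn_gt0.
rewrite finset.in_setD in_simplex_support => /andP[jT xj].
have xi : x ord0 i != 0 by move/fintype.subsetP: TS => /(_ _ iT); rewrite inE.
have [t [y [z [/andP[t0 t1] [Sy Sz] suppy suppz xE]]]] :=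
  std_simplex_split Sx (ex_intro2 _ _ i iT xi) (ex_intro2 _ _ j jT xj).
have fy : f y <= k%:R.
  apply: IH => //; rewrite -cT; apply/subset_leq_card/fintype.subsetP => l.
  by rewrite in_simplex_support suppy => /andP[].
have fz : f z <= k%:R.
  apply: IH => //; apply: leq_trans cD; apply/subset_leq_card/fintype.subsetP => l.
  by rewrite finset.in_setD !in_simplex_support suppz.
have := fc y z t Sy Sz; rewrite t0 t1 -xE => /(_ isT) /le_trans; apply.
rewrite -natr1 lerD2r; have -> : k%:R = t * k%:R + (1 - t) * k%:R :> R by ring.
by rewrite lerD// ler_wpM2l// subr_ge0.
Qed.

Lemma center_std_simplex n : std_simplex n (const_mx n.+1%:R^-1 : 'rV[R]_n.+1).
Proof.
split=> [i|]; first by rewrite mxE invr_ge0.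
under eq_bigr do rewrite mxE.
by rewrite sumr_const card_ord -[LHS]mulr_natr mulVf// pnatr_eq0.
Qed.

Lemma kappa_le_up_log n : (@kappa R n <= (up_log 2 n.+1)%:R%:E)%E.
Proof.
apply: ge_ereal_sup => _ [f [x [fc fv Sx ->]]]; rewrite lee_fin.
apply: approx_convex_support_le fc fv _ Sx _.
apply: leq_trans (max_card _) _; rewrite card_ord.
exact: up_logP.
Qed.

(** A function with values in [[0, 1]] is approximately convex; take 0 at the vertices and 1
    elsewhere. For [1 <= n] the centre is not a vertex. This makes [kappa n] positive, as
    admissibility demands. *)
Lemma kappa_ge1 n : (1 <= n)%N -> (1 <= @kappa R n)%E.
Proof.
move=> n0; apply: ereal_sup_ubound.
pose f (x : 'rV[R]_n.+1) := if x \in [seq simplex_vertex n i | i : 'I_n.+1]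
  then 0 else 1 : R.
have f0 x : 0 <= f x by rewrite /f; case: ifP.
have f1 x : f x <= 1 by rewrite /f; case: ifP.
pose c : 'rV[R]_n.+1 := const_mx (n.+1%:R^-1).
have cE : f c = 1.
  rewrite /f; case: ifP => // /mapP[i _ /rowP/(_ i)]; rewrite !mxE eqxx.
  move=> /(congr1 (fun x => x^-1)); rewrite invrK invr1 => /eqP.
  by rewrite pnatr_eq1 eqSS => /eqP n00; rewrite n00 in n0.
exists f, c; split.
- move=> x y t _ _ /andP[t0 t1]; apply: le_trans (f1 _) _.
  by rewrite lerDr addr_ge0// mulr_ge0// subr_ge0.
- by move=> i; rewrite /f map_f// mem_enum.
- exact: center_std_simplex.
- by rewrite cE.
Qed.

Lemma log2_expn k : log2 ((2 ^ k)%:R : R) = k%:R.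
Proof.
rewrite /log2 natrX lnXn// -[ln 2 *+ k]mulr_natr mulrAC divff ?mul1r//.
by rewrite gt_eqF// ln_gt0// ltr1n.
Qed.

Lemma ler_log2 (x y : R) : 0 < x -> x <= y -> log2 x <= log2 y.
Proof.
move=> x0 xy; rewrite ler_pM2r ?invr_gt0 ?ln_gt0 ?ltr1n//.
by rewrite ler_ln// posrE// (lt_le_trans x0).
Qed.

Lemma ltr_log2 (x y : R) : 0 < x -> x < y -> log2 x < log2 y.
Proof.
move=> x0 xy; rewrite ltr_pM2r ?invr_gt0 ?ln_gt0 ?ltr1n//.
by rewrite ltr_ln// posrE// (lt_trans x0).
Qed.

Lemma ceil_log2 n : (1 <= n)%N ->
  Num.ceil (log2 (n.+1%:R : R)) = (up_log 2 n.+1)%:Z.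
Proof.
move=> n0; have /andP[lo hi] := @up_log_bounds 2 n.+1 isT n0.
have k0 : (0 < up_log 2 n.+1)%N by rewrite up_log_gt0.
apply: ceil_def; rewrite -{1}(prednK k0) intS addrAC subrr add0r.
apply/andP; split.
  by rewrite -[ltLHS]log2_expn ltr_log2 ?ltr0n ?expn_gt0// ltr_nat.
by rewrite -[leRHS]log2_expn ler_log2// ler_nat.
Qed.

Lemma up_log_le_log2 n : (1 <= n)%N ->
  (up_log 2 n.+1)%:R <= log2 (n%:R : R) + 1.
Proof.
move=> n0; have /andP[lo hi] := @up_log_bounds 2 n.+1 isT n0.
have k0 : (0 < up_log 2 n.+1)%N by rewrite up_log_gt0.
rewrite -{1}(prednK k0) -natr1 lerD2r -[leLHS]log2_expn.
(* With [k] the rounded-up logarithm, [2 ^ k.-1 < n.+1] means [2 ^ k.-1 <= n], which turns [n.+1]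
   into [n]. *)
by rewrite ler_log2 ?ltr0n ?expn_gt0// ler_nat -ltnS.
Qed.

End Kappa.

(** * Admissibility of [kappa n] *)

Lemma kappa_fin_num (R : realType) n : (1 <= n)%N -> @kappa R n \is a fin_num.
Proof.
move=> n0; rewrite ge0_fin_numE; last exact: le_trans (kappa_ge1 n0).
exact: le_lt_trans (kappa_le_up_log n) (ltry _).
Qed.

Lemma kappa_admissible (R : realType) (X : normedModType R) (n : nat)
    (e : {linear 'rV[R]_n -> X}) : (1 <= n)%N -> bijective e ->
  admissible_const X (fine (@kappa R n)).
Proof.
move=> n0 e_bij; set C := fine _.
have kE : @kappa R n = C%:E by rewrite fineK// kappa_fin_num.
have C0 : 0 < C by rewrite -lte_fin -kE (lt_le_trans _ (kappa_ge1 n0)).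
split=> // A A0.
have N0 := nonconvexity_ge0 A0.
case NE : (nonconvexity A) N0 => [s| |] // s0; last by rewrite gt0_muley ?leey.
rewrite lee_fin in s0.
rewrite -EFinM; apply: hausdorff_le; first by rewrite mulr_ge0// ltW.
  exact: sub_convex_hull.
move=> y /(caratheodory e_bij)[a [w [Aa Sw yE]]].
rewrite -(fineK (pdist_fin_num y A0)) lee_fin; apply/ler_addgt0Pr => eps eps0.
(* The slack makes [r] positive and strictly larger than the nonconvexity, even when the latter is
   0. *)
have sr : s < s + eps / C by rewrite ltrDl divr_gt0.
have -> : C * s + eps = C * (s + eps / C) by field; rewrite gt_eqF.
set r := s + eps / C in sr *; have r0 : 0 < r by exact: le_lt_trans sr.
rewrite -ler_pdivrMr// -lee_fin -kE; apply: ereal_sup_ubound.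
(* The scaled distance pulled back along [g] competes in the supremum defining [kappa n], since [g]
   sends the vertices to the points [a i] of [A]. *)
pose g (u : 'rV[R]_n.+1) := \sum_i u 0 i *: a i.
exists ((fun x => fine (pdist x A) / r) \o g), w; split=> //.
- apply: (@approx_convex_comp _ _ _ _ setT) => [//|t u v|]; last first.
    by apply: approx_convex_pdist => //; rewrite NE lte_fin.
  rewrite /g !scaler_sumr -big_split/=; apply: eq_bigr => i _.
  by rewrite !mxE [LHS]scalerDl -!scalerA.
- move=> i /=; suff -> : g (simplex_vertex n i) = a i.
    by rewrite pdist_mem// mul0r.
  rewrite /g (bigD1 i)//= mxE eqxx scale1r big1 ?addr0// => j /negbTE ji.
  by rewrite mxE ji scale0r.
- by rewrite /= /g -yE.
Qed.

(** * Entropy *)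

Section Entropy.
Context {R : realType}.
Implicit Types (x y a b c t : R).

(** The summand of Shannon entropy in natural units; the factor [x] yields the convention that it
    vanishes at 0. *)
Definition nxlnx x : R := - (x * ln x).

Lemma nxlnx0 : nxlnx 0 = 0.
Proof. by rewrite /nxlnx mul0r oppr0. Qed.

Lemma nxlnx_ge0 x : 0 <= x <= 1 -> 0 <= nxlnx x.
Proof.
by move=> /andP[x0 x1]; rewrite oppr_ge0 mulr_ge0_le0// ln_le0.
Qed.

Lemma nxlnxM t a : 0 <= t -> 0 <= a -> nxlnx (t * a) = t * nxlnx a + a * nxlnx t.
Proof.
rewrite le_eqVlt => /predU1P[<- _|t0]; first by rewrite !(mul0r, nxlnx0) mulr0 addr0.
rewrite le_eqVlt => /predU1P[<-|a0]; first by rewrite !(mulr0, mul0r, nxlnx0) addr0.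
by rewrite /nxlnx lnM ?posrE//; ring.
Qed.

Lemma nxlnx_le p x : 0 <= p -> p <= x -> - (p * ln x) <= nxlnx p.
Proof.
rewrite le_eqVlt => /predU1P[<- _|p0 px]; first by rewrite nxlnx0 mul0r oppr0.
by rewrite lerN2 ler_pM2l// ler_ln ?posrE// (lt_le_trans p0).
Qed.

(** Split [z * ln z] along [z = t * a + (1 - t) * b]. Each part is at most [z], so monotonicity of
    [ln] bounds its share, and the product rule [nxlnxM] expands the result. *)
Lemma nxlnx_comb t a b : 0 <= t <= 1 -> 0 <= a -> 0 <= b ->
  nxlnx (t * a + (1 - t) * b) <=
    t * nxlnx a + (1 - t) * nxlnx b + a * nxlnx t + b * nxlnx (1 - t).
Proof.
move=> /andP[t0 t1] a0 b0; have u0 : 0 <= 1 - t by rewrite subr_ge0.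
have ta : 0 <= t * a by rewrite mulr_ge0.
have ub : 0 <= (1 - t) * b by rewrite mulr_ge0.
have := lerD (@nxlnx_le (t * a) (t * a + (1 - t) * b) ta _)
             (@nxlnx_le ((1 - t) * b) (t * a + (1 - t) * b) ub _).
rewrite lerDl lerDr => /(_ ub ta); rewrite !nxlnxM//.
set z := t * a + (1 - t) * b; rewrite -opprD -mulrDl -/z -/(nxlnx z).
by move=> /le_trans; apply; rewrite addrACA addrA.
Qed.

(** This is [ln (x / c) <= x / c - 1] multiplied by [x]; equality holds at [x = c]. *)
Lemma nxlnx_tangent c x : 0 < c -> 0 <= x ->
  - (x * ln c) - x * (x / c - 1) <= nxlnx x.
Proof.
move=> c0; rewrite le_eqVlt => /predU1P[<-|x0].
  by rewrite nxlnx0 !mul0r oppr0 addr0.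
have : ln (1 + (x / c - 1)) <= x / c - 1.
  by apply: le_ln1Dx; rewrite ltrBrDr addNr divr_gt0.
rewrite addrC subrK ln_div ?posrE// => /(ler_wpM2l (ltW x0)).
by rewrite mulrBr /nxlnx => ?; lra.
Qed.

(** The right side is the tangent line at [1 / 2]. Adding its values at [t] and [1 - t] gives
    exactly [ln 2]. *)
Lemma nxlnx_le_half t : 0 <= t -> nxlnx t <= t * ln 2 + (2^-1 - t).
Proof.
rewrite le_eqVlt => /predU1P[<-|t0].
  by rewrite nxlnx0 mul0r add0r subr0 invr_ge0.
have t20 : 0 < (2 * t)^-1 by rewrite invr_gt0 mulr_gt0.
have : ln (1 + ((2 * t)^-1 - 1)) <= (2 * t)^-1 - 1.
  by apply: le_ln1Dx; rewrite ltrBrDr addNr.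
rewrite addrC subrK lnV ?posrE ?mulr_gt0// lnM ?posrE// => /(ler_wpM2l (ltW t0)).
have -> : t * ((2 * t)^-1 - 1) = 2^-1 - t by field; rewrite gt_eqF.
by rewrite /nxlnx => ?; lra.
Qed.

Lemma binary_entropy_le t : 0 <= t <= 1 -> nxlnx t + nxlnx (1 - t) <= ln 2.
Proof.
move=> /andP[t0 t1]; have u0 : 0 <= 1 - t by rewrite subr_ge0.
by have := nxlnx_le_half t0; have := nxlnx_le_half u0; lra.
Qed.

(** Division by [ln 2] measures in bits, so that mixing two points costs at most the constant 1 of
    approximate convexity. *)
Definition entropy n (x : 'rV[R]_n.+1) : R :=
  (\sum_i nxlnx (x ord0 i)) / ln 2.

Let ln2_gt0 : 0 < ln 2 :> R.
Proof. by rewrite ln_gt0// ltr1n. Qed.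

Lemma std_simplex_le1 n (x : 'rV[R]_n.+1) i : std_simplex n x -> x ord0 i <= 1.
Proof.
move=> [x0 <-]; rewrite (bigD1 i)//= lerDl.
by apply: sumr_ge0.
Qed.

Lemma std_simplex_comb n (x y : 'rV[R]_n.+1) t : 0 <= t <= 1 ->
  std_simplex n x -> std_simplex n y -> std_simplex n (t *: x + (1 - t) *: y).
Proof.
move=> /andP[t0 t1] [x0 xs] [y0 ys]; split=> [i|].
  by rewrite !mxE addr_ge0 ?mulr_ge0// subr_ge0.
under eq_bigr do rewrite !mxE.
by rewrite big_split/= -!mulr_sumr xs ys !mulr1 subrKC.
Qed.

Lemma std_simplex_vertex n i : std_simplex n (simplex_vertex n i : 'rV[R]_n.+1).
Proof.
split=> [j|]; first by rewrite mxE; case: ifP.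
under eq_bigr do rewrite mxE.
by rewrite -big_mkcond/= big_pred1_eq.
Qed.

Lemma entropy_ge0 n (x : 'rV[R]_n.+1) : std_simplex n x -> 0 <= entropy x.
Proof.
move=> Sx; rewrite divr_ge0 ?(ltW ln2_gt0)//; apply: sumr_ge0 => i _.
by rewrite nxlnx_ge0// std_simplex_le1// andbT; case: Sx.
Qed.

Lemma entropy_vertex n i : entropy (simplex_vertex n i) = 0.
Proof.
rewrite /entropy big1 ?mul0r// => j _; rewrite mxE.
by case: ifP => _; rewrite ?nxlnx0// /nxlnx ln1 mulr0 oppr0.
Qed.

(** Sum [nxlnx_comb] over the coordinates: since those of [x] and of [y] sum to 1, the extra terms
    collapse to the binary entropy of [t]. *)
Lemma approx_convex_entropy n : approx_convex (std_simplex n) (@entropy n).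
Proof.
move=> x y t [x0 xs] [y0 ys] t01; rewrite -(ler_pM2r ln2_gt0).
have -> : (t * entropy x + (1 - t) * entropy y + 1) * ln 2 =
    t * (\sum_i nxlnx (x ord0 i)) + (1 - t) * (\sum_i nxlnx (y ord0 i)) + ln 2.
  by rewrite /entropy; field; rewrite gt_eqF.
rewrite /entropy divfK ?gt_eqF//.
apply: (@le_trans _ _ (\sum_i (t * nxlnx (x ord0 i) + (1 - t) * nxlnx (y ord0 i)
    + x ord0 i * nxlnx t + y ord0 i * nxlnx (1 - t)))).
  by apply: ler_sum => i _; rewrite !mxE; exact: nxlnx_comb.
rewrite !big_split/= -!mulr_sumr -!mulr_suml xs ys !mul1r -[leLHS]addrA.
by apply: lerD => //; exact: binary_entropy_le.
Qed.

Lemma entropy_near_center n (x : 'rV[R]_n.+1) d : std_simplex n x ->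
  (forall i, x ord0 i <= n.+1%:R^-1 + d) ->
  log2 (n.+1%:R) - n.+1%:R * d / ln 2 <= entropy x.
Proof.
move=> [x0 xs] xd; rewrite /log2 -mulrBl ler_pM2r ?invr_gt0//.
have N0 : 0 < n.+1%:R :> R by rewrite ltr0n.
(* The left side becomes an average with weights [x ord0 i], to be compared term by term with the
   bound at [c = 1 / n.+1]. *)
rewrite -[leLHS]mul1r -[X in X * _ <= _]xs mulr_suml; apply: ler_sum => i _.
have V0 : 0 < n.+1%:R^-1 :> R by rewrite invr_gt0.
apply: le_trans (nxlnx_tangent V0 (x0 i)).
rewrite lnV ?posrE// invrK; set N := n.+1%:R in N0 xd *.
have : x ord0 i * N - 1 <= N * d.
  rewrite lerBlDl -ler_pdivlMr// mulrDl mul1r [N * d]mulrC mulfK ?gt_eqF//.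
by move=> /(ler_wpM2l (x0 i)); lra.
Qed.

End Entropy.

(** * Lower bounds for admissible constants *)

Section LowerBound.
Context {R : realType} {X : normedModType R}.

Lemma coord_le_norm n (u : 'rV[R]_n) i : `|u ord0 i| <= `|u|.
Proof.
rewrite [leRHS]/Num.Def.normr/= mx_normrE.
exact: (le_bigmax 0 (fun ij : 'I_1 * 'I_n => `|u ij.1 ij.2|) (ord0, i)).
Qed.

Lemma linear_rV_continuous n (e : {linear 'rV[R]_n -> X}) : continuous e.
Proof.
apply: bounded_linear_continuous; apply/linear_boundedP; near=> r => u.
have : `|e u| <= (\sum_i `|e (delta_mx 0 i)|) * `|u|.
  rewrite {1}(row_sum_delta u) linear_sum mulr_suml.
  apply: le_trans (ler_norm_sum _ _ _) _; apply: ler_sum => i _.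
  by rewrite linearZ/= normrZ mulrC ler_wpM2l// coord_le_norm.
move=> /le_trans; apply; apply: ler_wpM2r; first exact: normr_ge0.
by near: r; apply: nbhs_pinfty_ge; rewrite num_real.
Unshelve. all: by end_near. Qed.

(** The minimum of [|e u|] over the compact unit sphere is positive by injectivity; homogeneity does
    the rest. *)
Lemma linear_rV_norm_ge n (e : {linear 'rV[R]_n -> X}) : injective e ->
  exists2 c : R, 0 < c & forall u, c * `|u| <= `|e u|.
Proof.
move=> e_inj; pose S := [set u : 'rV[R]_n | `|u| = 1].
suff [c c0 cS] : exists2 c : R, 0 < c & forall u, S u -> c <= `|e u|.
  exists c => // u; have [->|u0] := eqVneq u 0; first by rewrite normr0 mulr0.
  have nu0 : 0 < `|u| by rewrite normr_gt0.
  have := cS (`|u|^-1 *: u); rewrite linearZ /S/= !normrZ ger0_norm ?invr_ge0//.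
  by rewrite mulVf ?gt_eqF// ler_pdivlMl// mulrC => /(_ erefl).
(* The sphere is empty when [n = 0]; any constant then serves. *)
have [S0|/set0P S0] := eqVneq S set0; first by exists 1 => // u; rewrite S0.
have Scomp : compact S.
  apply: bounded_closed_compact.
    by exists 1; split=> [|r r1 u uS]; rewrite ?num_real//= uS ltW.
  apply: (@closed_comp _ _ (fun u : 'rV[R]_n => `|u|) [set 1]) => [u _|].
    exact: norm_continuous.
  exact: closed_eq.
have cont : {within S, continuous (fun u => `|e u|)}.
  apply: continuous_subspaceT => u.
  by apply: continuous_comp; [exact: linear_rV_continuous|exact: norm_continuous].
have [v /set_mem vS vmin] := compact_EVT_min S0 Scomp cont.
exists `|e v|; last by move=> u /mem_set /vmin.
rewrite normr_gt0; apply: contraPneq vS => ev0; rewrite /S/=.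
have -> : v = 0 by apply: e_inj; rewrite ev0 linear0.
by rewrite normr0 => /esym/eqP; rewrite oner_eq0.
Qed.

(* [v] almost attains the norm of the functional [\sum_i u i], so moving inside
   a level set of that functional hardly shortens [s *: v]. *)
Lemma almost_orthogonal_direction n (e : {linear 'rV[R]_n.+1 -> X}) (eps : R) :
  injective e -> 0 < eps ->
  exists2 v : X, `|v| = 1 & forall (u : 'rV[R]_n.+1) (s : R),
    \sum_i u ord0 i = 0 -> 0 <= s -> s <= (1 + eps) * `|e u + s *: v|.
Proof.
move=> e_inj eps0; have [c c0 ce] := linear_rV_norm_ge e_inj.
pose E := [set `|e u| | u in [set u : 'rV[R]_n.+1 | \sum_i u ord0 i = 1]].
have E0 : E !=set0.
  exists `|e (delta_mx ord0 ord0)|, (delta_mx ord0 ord0) => //=.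
  rewrite (bigD1 ord0)//= mxE !eqxx big1 ?addr0// => i /negbTE i0.
  by rewrite mxE i0 andbF.
have N0 : 0 < n.+1%:R :> R by rewrite ltr0n.
(* Coordinates summing to 1 force the sup norm of [u] to be at least [1 / n.+1]. *)
have Elb : lbound E (c / n.+1%:R).
  move=> _ [u /= us <-]; rewrite ler_pdivrMr//.
  have : 1 <= n.+1%:R * `|u|.
    rewrite -[leLHS]us; apply: le_trans (ler_norm _) _.
    apply: le_trans (ler_norm_sum _ _ _) _.
    have /le_trans : \sum_i `|u ord0 i| <= \sum_(i < n.+1) `|u|.
      by apply: ler_sum => i _; exact: coord_le_norm.
    by apply; rewrite sumr_const card_ord -[leLHS]mulr_natl.
  move=> /(ler_wpM2l (ltW c0)); rewrite mulr1 => /le_trans; apply.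
  by rewrite mulrCA mulrC ler_pM2r.
set d := inf E.
have d0 : 0 < d by apply: lt_le_trans (lb_le_inf E0 Elb); rewrite divr_gt0.
have dE (u : 'rV[R]_n.+1) : \sum_i u ord0 i = 1 -> d <= `|e u|.
  by move=> us; apply: ge_inf; [exists (c / n.+1%:R)|exists u].
have [_ [u0 /= u0s <-] u0d] : exists2 x, E x & x < d + d * eps.
  by apply: inf_adherent; [rewrite mulr_gt0|split => //; exists (c / n.+1%:R)].
set r := `|e u0| in u0d; have r0 : 0 < r by exact: lt_le_trans (dE _ u0s).
exists (r^-1 *: e u0).
  by rewrite normrZ gtr0_norm ?invr_gt0// mulVf// gt_eqF.
move=> u s us; rewrite le_eqVlt => /predU1P[<-|s0].
  by rewrite mulr_ge0// addr_ge0// ltW.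
(* Pulling out [s / r] leaves a vector of coordinate sum 1, whose image has norm at least [d], while
   [r < d * (1 + eps)]. *)
have -> : e u + s *: (r^-1 *: e u0) = (s / r) *: e ((r / s) *: u + u0).
  rewrite linearD [e (_ *: _)]linearZ/= scalerDr !scalerA mulrA.
  by rewrite divfK ?divff ?scale1r// gt_eqF.
have /dE : \sum_i ((r / s) *: u + u0) ord0 i = 1.
  under eq_bigr do rewrite !mxE.
  by rewrite big_split/= -mulr_sumr us mulr0 add0r.
rewrite normrZ gtr0_norm ?divr_gt0//; set q := `|e _| => dq.
have rq : r <= (1 + eps) * q.
  apply: le_trans (ltW u0d) _; rewrite -[X in X + _]mulr1 -mulrDr mulrC.
  by rewrite ler_pM2l// addr_gt0.
have := ler_wpM2l (ltW (divr_gt0 s0 r0)) rq.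
by rewrite divfK ?gt_eqF// mulrCA.
Qed.

Lemma convex_hull_comb (A : set X) (t : R) a b : 0 <= t <= 1 -> A a -> A b ->
  convex_hull A (t *: a + (1 - t) *: b).
Proof.
move=> /andP[t0 t1] Aa Ab.
exists 2%N, (fun i => if i == ord0 then a else b),
  (fun i => if i == ord0 then t else 1 - t); split=> [i|i||].
- by case: ifP.
- by case: ifP; rewrite ?subr_ge0.
- by rewrite !big_ord_recl big_ord0/= addr0 subrKC.
- by rewrite !big_ord_recl big_ord0/= addr0.
Qed.

(* Tested on the pair [set 0; u]. *)
Lemma admissible_const_ge_half (C : R) (u : X) : `|u| = 1 ->
  admissible_const X C -> 2^-1 <= C.
Proof.
move=> u1 [C0 adm]; pose A := [set 0; u].
have A0 : A 0 by left.
have Au : A u by right.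
have Nle : (nonconvexity A <= 1%:E)%E.
  apply: nonconvexity_le => // t a b /andP[t0 t1] Aa Ab.
  have t1' : 0 <= 1 - t by rewrite subr_ge0.
  apply: le_trans (pdist_le _ A0) _; rewrite lee_fin subr0.
  apply: le_trans (ler_normD _ _) _.
  have Ale x : A x -> `|x| <= 1 by case=> ->; rewrite ?normr0 ?u1.
  rewrite !normrZ !ger0_norm// -(subrKC t 1); apply: lerD.
    by rewrite ler_piMr// Ale.
  by rewrite addrAC subrr add0r ler_piMr// Ale.
have := adm A (ex_intro _ _ A0).
(* The midpoint lies at distance [1 / 2] from both points of the pair. *)
have half : 0 <= (2^-1 : R) <= 1 by lra.
move=> /(le_trans (pdist_le_hausdorff A (convex_hull_comb half A0 Au))).
move=> /le_trans/(_ (lee_wpmul2l _ Nle)); rewrite lee_fin ltW// mule1 => /(_ isT).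
rewrite -lee_fin; apply: le_trans; apply: le_ereal_inf_tmp => _ [a Aa <-].
rewrite lee_fin scaler0 add0r; case: Aa => ->.
  by rewrite subr0 normrZ u1 mulr1 ger0_norm; lra.
rewrite -[X in _ <= `|_ - X|]scale1r -scalerBl normrZ u1 mulr1.
by rewrite ler0_norm; lra.
Qed.

Lemma center_sum_vertex n :
  const_mx n.+1%:R^-1 = \sum_i n.+1%:R^-1 *: simplex_vertex n i :> 'rV[R]_n.+1.
Proof.
apply/rowP => j; rewrite summxE (bigD1 j)//= !mxE eqxx mulr1 big1 ?addr0//.
by move=> i ij; rewrite !mxE eq_sym (negbTE ij) mulr0.
Qed.

Definition entropy_epigraph n (e : 'rV[R]_n.+1 -> X) (M : R) (v : X) : set X :=
  [set z | exists (x : 'rV[R]_n.+1) (s : R),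
    [/\ std_simplex n x, entropy x <= s & z = M *: e x + s *: v]].

(** Raising a convex combination of two points by the unit vector [v] lands in the set, because
    entropy exceeds its chords by at most 1. *)
Lemma nonconvexity_entropy_epigraph n (e : {linear 'rV[R]_n.+1 -> X}) M v :
  `|v| = 1 -> (nonconvexity (entropy_epigraph e M v) <= 1%:E)%E.
Proof.
move=> v1; apply: nonconvexity_le => // t a b t01.
move=> [x [s [Sx xs ->]]] [y [s' [Sy ys' ->]]].
have /andP[t0 t1] := t01; have t1' : 0 <= 1 - t by rewrite subr_ge0.
set z := (X in pdist X _).
set w := t *: x + (1 - t) *: y; set r := t * s + (1 - t) * s'.
have zE : z = M *: e w + r *: v.
  rewrite /w linearD [e (t *: _)]linearZ [e ((1 - t) *: _)]linearZ/=.
  rewrite /z /r !scalerDr !scalerA [(t * s + _) *: v]scalerDl [LHS]addrACA.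
  by rewrite [M * t]mulrC [M * (1 - t)]mulrC.
have Az : entropy_epigraph e M v (M *: e w + (r + 1) *: v).
  exists w, (r + 1); split=> //; first exact: std_simplex_comb.
  apply: le_trans (approx_convex_entropy Sx Sy t01) _.
  by rewrite lerD2r lerD// ler_wpM2l.
apply: le_trans (pdist_le _ Az) _; rewrite lee_fin zE scalerDl scale1r.
by rewrite addrA opprD addrA subrr add0r normrN v1.
Qed.

(** Entropy vanishes at the vertices, so their images at height 0 lie in the set; the point is their
    mean. *)
Lemma center_in_hull n (e : {linear 'rV[R]_n.+1 -> X}) M v :
  convex_hull (entropy_epigraph e M v) (M *: e (const_mx n.+1%:R^-1)).
Proof.
have [c0 cs] := @center_std_simplex R n.
exists n.+1, (fun i => M *: e (simplex_vertex n i)), (fun=> n.+1%:R^-1).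
split=> [i|i||].
- exists (simplex_vertex n i), 0; rewrite entropy_vertex scale0r addr0.
  by split=> //; exact: std_simplex_vertex.
- by rewrite invr_ge0.
- by rewrite -[RHS]cs; apply: eq_bigr => i _; rewrite mxE.
- rewrite center_sum_vertex linear_sum scaler_sumr; apply: eq_bigr => i _.
  by rewrite linearZ/= !scalerA mulrC.
Qed.

(** Some point of the set, over [x] at height [s], is within [C + eps] of the centre. Almost
    orthogonality bounds [s], a large [M] forces [x] near [o], and [s] is at least the entropy
    there. *)
Lemma admissible_const_ge_approx n (e : {linear 'rV[R]_n.+1 -> X}) (C eps : R) :
  injective e -> admissible_const X C -> 0 < eps ->
  log2 (n.+1%:R) - eps <= (1 + eps) * (C + eps).
Proof.
move=> e_inj [C0 adm] eps0.
have [c c0 ce] := linear_rV_norm_ge e_inj.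
have [v v1 vorth] := almost_orthogonal_direction e_inj eps0.
have ln2 : 0 < ln 2 :> R by rewrite ln_gt0// ltr1n.
set N : R := n.+1%:R; have N0 : 0 < N by rewrite ltr0n.
(* [K] adds the distance to the centre and the bound on the height, hence bounds [|e u|]. [M] is
   chosen so that [K / (c * M) = eps * ln 2 / N], a displacement costing exactly [eps] of
   entropy. *)
set K := (C + eps) + (1 + eps) * (C + eps).
have K0 : 0 < K by rewrite addr_gt0// ?mulr_gt0// addr_gt0.
pose M := K * N / (c * eps * ln 2).
have M0 : 0 < M by rewrite divr_gt0// !mulr_gt0.
set A := entropy_epigraph e M v; set o := const_mx n.+1%:R^-1 : 'rV[R]_n.+1.
have [So os] : std_simplex n o := center_std_simplex n.
have A0 : A !=set0.
  exists (M *: e o + entropy o *: v), o, (entropy o); split=> //.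
have /pdist_lt[_ [x [s [Sx xs ->]]]] : (pdist (M *: e o)%R A < (C + eps)%:E)%E.
  apply: (@le_lt_trans _ _ C%:E); last by rewrite lte_fin ltrDl.
  apply: le_trans (pdist_le_hausdorff A (center_in_hull e M v)) _.
  apply: le_trans (adm A A0) _; rewrite -[leRHS]mule1.
  apply: lee_wpmul2l; first by rewrite lee_fin ltW.
  exact: nonconvexity_entropy_epigraph.
have s0 : 0 <= s by apply: le_trans xs; exact: entropy_ge0.
rewrite distrC addrAC -scalerBr -linearB -linearZ/=; set u := M *: _ => uv.
(* Both [x] and [o] have coordinate sum 1, so [u] is parallel to the hyperplane. *)
have us : \sum_i u ord0 i = 0.
  under eq_bigr do rewrite mxE [(x - o) _ _]mxE [(- o) _ _]mxE.
  by case: Sx => _ xs1; rewrite -mulr_sumr sumrB xs1 os subrr mulr0.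
have sle : s <= (1 + eps) * (C + eps).
  apply: le_trans (vorth u s us s0) _; rewrite ler_pM2l ?addr_gt0//; exact: ltW.
have uK : `|e u| <= K.
  rewrite -[e u](addrK (s *: v)); apply: le_trans (ler_normB _ _) _.
  by rewrite normrZ v1 mulr1 ger0_norm// lerD// ltW.
apply: le_trans sle; apply: le_trans xs.
have xo : `|x - o| <= eps * ln 2 / N.
  have := le_trans (ce u) uK; rewrite /u normrZ gtr0_norm//.
  have cM0 : 0 < c * M by exact: mulr_gt0.
  rewrite mulrA -ler_pdivlMl// => /le_trans; apply.
  by rewrite le_eqVlt; apply/orP; left; apply/eqP; rewrite /M; field;
    rewrite ?gt_eqF.
have := @entropy_near_center R n x (eps * ln 2 / N) Sx.
have -> : n.+1%:R * (eps * ln 2 / N) / ln 2 = eps.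
  by rewrite -/N; field; rewrite ?gt_eqF.
apply => i; rewrite -lerBlDl; apply: le_trans xo.
apply: le_trans (coord_le_norm (x - o) i); rewrite !mxE.
exact: ler_norm.
Qed.

Lemma admissible_const_ge_log2 n (e : {linear 'rV[R]_n.+1 -> X}) (C : R) :
  injective e -> admissible_const X C -> log2 (n.+1%:R) <= C.
Proof.
move=> e_inj adm; have C0 : 0 < C by case: adm.
apply/ler_addgt0Pr => d d0.
have C30 : 0 < C + 3 by rewrite addr_gt0.
(* As [eps <= 1], [(1 + eps) * (C + eps) + eps <= C + eps * (C + 3) <= C + d]. *)
set eps := Num.min 1 (d / (C + 3)).
have eps0 : 0 < eps by rewrite lt_min ltr01 divr_gt0.
have eps1 : eps <= 1 by rewrite ge_min lexx.
have epsd : eps * (C + 3) <= d by rewrite -ler_pdivlMr// ge_min lexx orbT.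
have := admissible_const_ge_approx e_inj adm eps0.
have : eps * eps <= eps by rewrite ler_piMr// ltW.
by lra.
Qed.

End LowerBound.

(** * Attainment of the least constant *)

Section LeastConstant.
Context {R : realType} {X : normedModType R}.

(** For finite positive nonconvexity the condition on a constant is a closed lower bound, which
    passes to the infimum. Nonconvexity 0 is settled by any admissible constant, and infinite
    nonconvexity by positivity. *)
Lemma admissible_const_inf (c : R) : 0 < c ->
  admissible_const X !=set0 -> lbound (admissible_const X) c ->
  admissible_const X (inf (admissible_const X)).
Proof.
move=> c0 S0 Sc; set C := inf _.
have C0 : 0 < C by exact: lt_le_trans c0 (lb_le_inf S0 Sc).
split=> // A A0; have N0 := nonconvexity_ge0 A0.
case NE : (nonconvexity A) N0 => [s| |] // s0; last by rewrite gt0_muley ?leey.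
rewrite lee_fin in s0.
have [D Dadm] := S0; move: s0; rewrite le_eqVlt => /predU1P[s0|s0].
  by have := Dadm.2 A A0; rewrite NE -s0 !mule0.
rewrite muleC -lee_pdivrMl//.
set h := (X in (X <= _)%E); suff [r hr rC] : exists2 r, (h <= r%:E)%E & r <= C.
  by rewrite (le_trans hr)// lee_fin.
have hS E : admissible_const X E -> (h <= E%:E)%E.
  by move=> [_ /(_ A A0)]; rewrite NE lee_pdivrMl// muleC.
case hE : h (hS D Dadm) => [r| |]// _; last by exists C => //; rewrite leNye.
exists r => //; apply: lb_le_inf => // E /hS.
by rewrite hE lee_fin.
Qed.

End LeastConstant.

Theorem theorem3p1 (R : realType) (X : normedModType R) (n : nat) (hn : (1 <= n)%N)
  (e : {linear 'rV[R]_n -> X}) (he : bijective e) :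
  exists C : R,
    [/\ admissible_const X C /\
          (forall C' : R, admissible_const X C' -> C <= C'),
        log2 (n%:R : R) <= C,
        (C%:E <= @kappa R n)%E,
        C <= (Num.ceil (log2 ((n.+1)%:R : R)))%:~R
      & (Num.ceil (log2 ((n.+1)%:R : R)))%:~R <= log2 (n%:R : R) + 1].
Proof.
have e_inj := bij_inj he.
have kadm := kappa_admissible hn he.
have [u u1] : exists u : X, `|u| = 1.
  have w0 : e (const_mx 1) != 0.
    rewrite -(linear0 e) (inj_eq e_inj); apply/eqP => /rowP/(_ (Ordinal hn)).
    by rewrite !mxE => /eqP; rewrite oner_eq0.
  exists (`|e (const_mx 1)|^-1 *: e (const_mx 1)).
  by rewrite normrZ ger0_norm ?invr_ge0// mulVf// normr_eq0.
(* This keeps the infimum positive even for [n = 1], where [log2 n] is 0. *)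
have half_lb : lbound (admissible_const X) 2^-1.
  by move=> C; exact: admissible_const_ge_half u1.
have S0 : admissible_const X !=set0 by exists (fine (@kappa R n)).
have infle C : admissible_const X C -> inf (admissible_const X) <= C.
  by move=> admC; apply: ge_inf => //; exists 2^-1.
have ceilE : (Num.ceil (log2 (n.+1%:R : R)))%:~R = (up_log 2 n.+1)%:R :> R.
  by rewrite ceil_log2.
have kfin := kappa_fin_num R hn.
exists (inf (admissible_const X)); split.
- split=> //; apply: admissible_const_inf S0 half_lb.
  by rewrite invr_gt0.
- apply: lb_le_inf => // C.
  (* The simplex with [n] vertices sits in row vectors of length [n], so the lower bound is applied
     at the predecessor of [n]. *)
  case: n hn e he e_inj {kadm S0 ceilE kfin} => // n _ e _.
  exact: admissible_const_ge_log2.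
- by rewrite -(fineK kfin) lee_fin infle.
- rewrite ceilE; apply: le_trans (infle _ kadm) _.
  by rewrite -lee_fin fineK// kappa_le_up_log.
- by rewrite ceilE up_log_le_log2.
Qed.
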